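(* For any $\rho \in \mathbb{D}$, the convex roof extension $\Gamma^\cup_{\mathcal{S}_+}(\rho)$ is equal to the atomic gauge $\Gamma_{\mathcal{S}^\cup_+}(\rho)$, where $$\mathcal{S}^\cup_+ = \{\, |a\rangle\langle a| \;:\; |a\rangle \in \mathrm{conv}(\mathcal{V}) \,\}.$$
   Context: Fix $d\ge 1$. $\mathcal{V}\subseteq\mathbb{C}^d$ is a nonempty compact set of unit vectors such that $|\psi\rangle\in\mathcal{V}$ implies $e^{i\theta}|\psi\rangle\in\mathcal{V}$ for all real $\theta$. $\mathbb{D}$ is the set of $d\times d$ density matrices (positive semidefinite, unit trace), and $\mathbb{R}_+=[0,\infty)$. For a compact set $\mathcal{A}$ in a finite-dimensional vector space, the atomic gauge is $\Gamma_{\mathcal{A}}(x)=\inf\{\lambda\in\mathbb{R}_+ : x\in\lambda\,\mathrm{conv}(\mathcal{A})\}=\inf\{\sum_i c_i : x=\sum_i c_i a_i \text{ (finite sum)},\ a_i\in\mathcal{A},\ c_i\in\mathbb{R}_+\}$, with $\inf\emptyset=\infty$. Thus $\Gamma_{\mathcal{V}}$ is a function on $\mathbb{C}^d$, and $\Gamma_{\mathcal{S}^\cup_+}$ is a function on Hermitian matrices. The convex roof extension is $$\Gamma^\cup_{\mathcal{S}_+}(\rho)=\inf\Big\{\sum_i p_i\,\Gamma_{\mathcal{V}}(|\psi_i\rangle)^2 : \rho=\sum_i p_i|\psi_i\rangle\langle\psi_i|,\ \sum_i p_i=1,\ p_i\in\mathbb{R}_+\Big\},$$ where the infimum is over finite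 decompositions with $|\psi_i\rangle\in\mathbb{C}^d$ unit vectors. *)

(* Defs.v *)
From HB Require Import structures.
From mathcomp Require Import all_boot all_order all_algebra.
From mathcomp Require Import spectral sesquilinear.
From mathcomp.real_closed Require Import complex.
From mathcomp Require Import all_classical all_reals all_analysis.
Import Order.TTheory GRing.Theory Num.Theory.
Import numFieldNormedType.Exports.
Set Implicit Arguments.
Unset Strict Implicit.
Unset Printing Implicit Defensive.
Local Open Scope classical_set_scope.
Local Open Scope ring_scope.
Local Open Scope complex_scope.
Local Open Scope sesquilinear_scope.

(* The usual topology on R[i], given by the modulus; it is what makes
   [compact] applicable to sets of complex matrices. *)
HB.instance Definition _ (R : realType) :=
  NormedModule.copy R[i] (R[i] : numFieldType)^o.

Section Gauge.
Context {R : realType}.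
Local Notation C := R[i].

(* Complex vector spaces are regarded as real ones: the coefficients are real,
   embedded into R[i] by %:C. *)
Definition conv_hull (E : lmodType C) (A : set E) : set E :=
  [set x | exists n (c : 'I_n -> R) (a : 'I_n -> E),
    [/\ forall i, 0 <= c i, \sum_i c i = 1, forall i, A (a i)
      & x = \sum_i (c i)%:C *: a i]].

(* Valued in \bar R, with ereal_inf set0 = +oo. *)
Definition atomic_gauge (E : lmodType C) (A : set E) (x : E) : \bar R :=
  ereal_inf [set l%:E | l in [set l : R |
    0 <= l /\ [set l%:C *: y | y in conv_hull A] x]].

Context {d : nat}.

(* The Hermitian norm is meant: the library's norm `|psi| on matrices is the
   sup norm. *)
Definition unit_vector (psi : 'cV[C]_d) : Prop :=
  (psi ^t* *m psi) 0 0 = 1.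

Definition ketbra (psi : 'cV[C]_d) : 'M[C]_d := psi *m psi ^t*.

(* e ^ (i t) *)
Definition phase (t : R) : C := cos t +i* sin t.

(* On R[i], 0 <= z means that z is real and nonnegative. *)
Definition density_matrix (rho : 'M[C]_d) : Prop :=
  [/\ rho \is hermsymmx,
      forall x : 'cV[C]_d, 0 <= (x ^t* *m rho *m x) 0 0
    & \tr rho = 1].

(* In \bar R, 0 * +oo = 0: vectors of infinite gauge are harmless when their
   weight is zero. *)
Definition gauge_convex_roof (V : set 'cV[C]_d) (rho : 'M[C]_d) : \bar R :=
  ereal_inf [set v : \bar R | exists n (p : 'I_n -> R) (psi : 'I_n -> 'cV[C]_d),
    [/\ forall i, 0 <= p i, \sum_i p i = 1, forall i, unit_vector (psi i),
        rho = \sum_i (p i)%:C *: ketbra (psi i)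
      & v = (\sum_i (p i)%:E * atomic_gauge V (psi i) ^+ 2)%E]].

End Gauge.

(* Main.v *)
Require Import Defs.
From mathcomp Require Import all_boot all_order all_algebra.
From mathcomp.real_closed Require Import complex.
From mathcomp Require Import all_classical all_reals all_analysis.
Import Order.TTheory GRing.Theory Num.Theory.
Import numFieldNormedType.Exports.
Local Open Scope classical_set_scope.
Local Open Scope ring_scope.
Local Open Scope complex_scope.

(* If psi = s a with a in conv(V), then |psi><psi| = s^2 |a><a|, so that weights
   p on unit vectors psi and weights p s^2 on atoms |a><a| describe the same
   matrix. From a roof decomposition, nearly optimal s turn the cost
   sum p Gamma(psi)^2 into the total weight of an atomic one; conversely,
   normalizing each a gives Gamma(psi) <= 1 / |a|, and the new weights sum to
   tr rho = 1. *)

(** The squared Hermitian norm of [a], in trace form so that weights can be compared with [\tr rho].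
    The trace is real, so the real part loses nothing. *)
Definition sqnorm {R : realType} {d : nat} (a : 'cV[R[i]]_d) : R :=
  complex.Re (\tr (ketbra a)).

Section AtomicGauge.
Context {R : realType} {E : lmodType R[i]} (A : set E).

Lemma atomic_gauge_ge0 (x : E) : (0 <= atomic_gauge A x)%E.
Proof. by apply: le_ereal_inf_tmp => _ [l [l0 _] <-]; rewrite lee_fin. Qed.

Lemma atomic_gauge_scale_le (s : R) (a : E) :
  0 <= s -> conv_hull A a -> (atomic_gauge A (s%:C *: a) <= s%:E)%E.
Proof. by move=> s0 Aa; apply: ereal_inf_lbound; exists s => //; split=> //; exists a. Qed.

(** Dividing the weights by their sum turns a conic combination into a multiple of a convex one,
    whence the demand that the sum be positive. *)
Lemma atomic_gauge_sum_le n (c : 'I_n -> R) (a : 'I_n -> E) :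
  (forall i, 0 <= c i) -> 0 < \sum_i c i -> (forall i, A (a i)) ->
  (atomic_gauge A (\sum_i (c i)%:C *: a i) <= (\sum_i c i)%:E)%E.
Proof.
move=> c0 s0 Aa; set s := \sum_i c i in s0 *.
have -> : \sum_i (c i)%:C *: a i = s%:C *: \sum_i (c i / s)%:C *: a i.
  rewrite scaler_sumr; apply: eq_bigr => i _.
  by rewrite scalerA -rmorphM/= mulrC divfK// gt_eqF.
apply: atomic_gauge_scale_le; first exact: ltW.
exists n, (fun i => c i / s), a; split=> //.
  by move=> i; rewrite divr_ge0// ltW.
by rewrite -mulr_suml divff// gt_eqF.
Qed.

(** Supplies a nearly optimal factorization. The slack [e] is put on the square because that is what
    the roof averages. *)
Lemma atomic_gauge_adherent (x : E) (r e : R) :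
  (atomic_gauge A x ^+ 2 <= r%:E)%E -> 0 < e ->
  exists s a, [/\ 0 <= s, conv_hull A a, x = s%:C *: a & s ^+ 2 <= r + e].
Proof.
move=> gr e0; have g0 := atomic_gauge_ge0 x.
have gfin : atomic_gauge A x \is a fin_num.
  rewrite ge0_fin_numE//; move: gr g0; case: (atomic_gauge A x) => [z| |]//=.
  by rewrite ltry.
have gE := fineK gfin; set g := fine _ in gE.
have gg0 : 0 <= g by rewrite -lee_fin gE.
have {}gr : g ^+ 2 <= r by rewrite -lee_fin EFin_expe gE.
have r0 : 0 <= r by apply: le_trans gr; exact: sqr_ge0.
(* Since [g ^+ 2 <= r < r + e], this threshold lies strictly above the infimum, so some admissible
   scale lies below it. *)
have : (atomic_gauge A x < (Num.sqrt (r + e))%:E)%E.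
  rewrite -gE lte_fin -(ger0_norm gg0) -sqrtr_sqr ltr_sqrt; last exact: ltr_wpDl.
  by rewrite (le_lt_trans gr)// ltrDl.
move=> /ereal_inf_lt [_ [s [s0 [a Aa <-]] <-]]; rewrite lte_fin => ls.
exists s, a; split=> //.
have re0 : 0 <= r + e by rewrite addr_ge0// ltW.
by rewrite -(sqr_sqrtr re0) lerXn2r ?nnegrE ?sqrtr_ge0// ltW.
Qed.

End AtomicGauge.

Section Ketbra.
Context {R : realType} {d : nat}.
Implicit Types a psi : 'cV[R[i]]_d.

Lemma ketbraZ (s : R) a : ketbra (s%:C *: a) = (s ^+ 2)%:C *: ketbra a.
Proof.
rewrite /ketbra; apply/matrixP => i j; rewrite !mxE !big_ord1 !mxE rmorphM/=.
have -> : Num.conj s%:C = s%:C by exact: conjc_real.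
by rewrite mulrACA rmorphXn.
Qed.

Lemma mxtrace_ketbraE a : \tr (ketbra a) = \sum_i `|a i 0| ^+ 2.
Proof.
by apply: eq_bigr => i _; rewrite !mxE big_ord1 !mxE normCK.
Qed.

Lemma mxtrace_ketbra a : \tr (ketbra a) = (sqnorm a)%:C.
Proof.
rewrite /sqnorm RRe_real// mxtrace_ketbraE ger0_real//.
by apply: sumr_ge0 => i _; rewrite exprn_ge0.
Qed.

Lemma unit_vectorE psi : unit_vector psi <-> \tr (ketbra psi) = 1.
Proof. by rewrite /unit_vector /ketbra mxtrace_mulC /mxtrace big_ord1. Qed.

Lemma sqnorm_ge0 a : 0 <= sqnorm a.
Proof.
rewrite -ler0c -mxtrace_ketbra mxtrace_ketbraE.
by apply: sumr_ge0 => i _; rewrite exprn_ge0.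
Qed.

Lemma sqnorm_eq0 a : sqnorm a = 0 -> a = 0.
Proof.
move=> a0; have : \tr (ketbra a) = 0 by rewrite mxtrace_ketbra a0.
rewrite mxtrace_ketbraE => /psumr_eq0P h.
apply/matrixP => i j; rewrite ord1 mxE; apply/eqP.
by rewrite -normr_eq0 -sqrf_eq0 h// => k _; rewrite exprn_ge0.
Qed.

(* For a = 0 any unit vector will do, hence [V_neq0]. *)
Lemma conv_hull_normalize (V : set 'cV[R[i]]_d) a :
  V !=set0 -> (forall psi, V psi -> unit_vector psi) -> conv_hull V a ->
  exists psi, [/\ unit_vector psi, ketbra a = (sqnorm a)%:C *: ketbra psi
    & ((sqnorm a)%:E * atomic_gauge V psi ^+ 2 <= 1)%E].
Proof.
move=> [v Vv] V_unit Va; have [a0|a_neq0] := eqVneq (sqnorm a) 0.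
  exists v; split; first exact: V_unit.
    by rewrite a0 scale0r (sqnorm_eq0 a a0) /ketbra mul0mx.
  by rewrite a0 mul0e.
have N0 : 0 < sqnorm a by rewrite lt_def a_neq0 sqnorm_ge0.
have s2 : ((Num.sqrt (sqnorm a))^-1) ^+ 2 = (sqnorm a)^-1.
  by rewrite exprVn sqr_sqrtr// ltW.
have Z : ketbra ((Num.sqrt (sqnorm a))^-1%:C *: a) = (sqnorm a)^-1%:C *: ketbra a.
  by rewrite ketbraZ s2.
exists ((Num.sqrt (sqnorm a))^-1%:C *: a); split.
- by apply/unit_vectorE; rewrite Z mxtraceZ mxtrace_ketbra -rmorphM/= mulVf.
- by rewrite Z scalerA -rmorphM/= mulfV// scale1r.
- have s0 : 0 <= (Num.sqrt (sqnorm a))^-1 by rewrite invr_ge0 sqrtr_ge0.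
  rewrite [leRHS](_ : _ = (sqnorm a)%:E * (Num.sqrt (sqnorm a))^-1%:E ^+ 2)%E.
    apply: lee_wpmul2l; first by rewrite lee_fin sqnorm_ge0.
    rewrite !expe2; have h := atomic_gauge_scale_le _ _ _ s0 Va.
    by apply: lee_pmul => //; exact: atomic_gauge_ge0.
  by rewrite -EFin_expe s2 -EFinM divff.
Qed.

End Ketbra.

Section ConvexRoof.
Context {R : realType} {d : nat} (V : set 'cV[R[i]]_d).
Context (V_neq0 : V !=set0) (V_unit : forall psi, V psi -> unit_vector psi).
Context (rho : 'M[R[i]]_d) (rho_tr1 : \tr rho = 1).

Lemma gauge_convex_roof_le :
  (gauge_convex_roof V rho <= atomic_gauge [set ketbra a | a in conv_hull V] rho)%E.
Proof.
apply: le_ereal_inf_tmp => _ [l [l0 [_ [n [c [K [c0 c1 VK ->]]]] yE]] <-].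
have /choice[a aP] : forall i, exists a, conv_hull V a /\ ketbra a = K i.
  by move=> i; have [a Va aK] := VK i; exists a.
have /choice[psi psiP] i := conv_hull_normalize _ _ V_neq0 V_unit (aP i).1.
have rhoE : rho = \sum_i (l * c i * sqnorm (a i))%:C *: ketbra (psi i).
  rewrite -yE scaler_sumr; apply: eq_bigr => i _.
  by have [_ e _] := psiP i; rewrite -(aP i).2 e !scalerA -!rmorphM.
apply: ge_ereal_inf; exists (\sum_i (l * c i * sqnorm (a i))%:E *
    atomic_gauge V (psi i) ^+ 2)%E.
  exists n, (fun i => l * c i * sqnorm (a i)), psi; split=> //.
  - by move=> i; rewrite !mulr_ge0// sqnorm_ge0.
  (* Take traces in [rhoE]: each [ketbra (psi i)] has trace 1, so the weights add up to
     [\tr rho]. *)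
  - apply/(@complexI R); rewrite -[RHS]rho_tr1 rhoE !raddf_sum/=.
    apply: eq_bigr => i _; have [/unit_vectorE u _ _] := psiP i.
    by rewrite mxtraceZ u mulr1.
  - by move=> i; have [] := psiP i.
(* Spreading [l] over the convex weights [c] allows a termwise comparison, where normalization
   bounds the factor of [l * c i] by 1. *)
rewrite [leRHS](_ : _ = \sum_i (l * c i)%:E)%E; last first.
  by rewrite sumEFin -mulr_sumr c1 mulr1.
apply: lee_sum => i _; have [_ _ g] := psiP i.
by rewrite EFinM -muleA -[leRHS]mule1 lee_wpmul2l// lee_fin mulr_ge0.
Qed.

Lemma atomic_gauge_le_roof :
  (atomic_gauge [set ketbra a | a in conv_hull V] rho <= gauge_convex_roof V rho)%E.
Proof.
apply: le_ereal_inf_tmp => _ [n [p [psi [p0 p1 psi_unit rhoE ->]]]].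
set G := fun i => atomic_gauge V (psi i).
have G0 i : (0 <= G i)%E by exact: atomic_gauge_ge0.
have t0 i : (0 <= (p i)%:E * G i ^+ 2)%E by rewrite mule_ge0 ?expe_ge0// lee_fin.
have [sy|/eqP sy] := eqVneq (\sum_i (p i)%:E * G i ^+ 2)%E +oo%E.
  by rewrite [leRHS]sy leey.
have tfin i : ((p i)%:E * G i ^+ 2 < +oo)%E.
  rewrite ltey; apply/eqP => ty; apply: sy; apply/esum_eqyP.
    by move=> j _; rewrite gt_eqF// (lt_le_trans _ (t0 j))// ltNy0.
  by exists i; rewrite mem_index_enum.
apply/lee_addgt0Pr => e e0.
(* The slack at index [i] is [p i * e], so that the total slack is [e] because the [p i] sum to
   1. *)
have /choice[q] : forall i, exists q : R * 'cV[R[i]]_d,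
    [/\ 0 <= q.1, conv_hull V q.2, (p i)%:C *: ketbra (psi i) = q.1%:C *: ketbra q.2
    & (q.1%:E <= (p i)%:E * G i ^+ 2 + (p i * e)%:E)%E].
  (* Where [p i] vanishes the gauge of [psi i] may be infinite, leaving no factorization to use.
     Weight 0 is then put on the atom of an arbitrary [v], seen as a one-point convex
     combination. *)
  move=> i; have [pi0|pi0] := eqVneq (p i) 0.
    have [v Vv] := V_neq0.
    exists (0, v); split=> //=; last by rewrite pi0 mul0e mul0r adde0.
      exists 1%N, (fun=> 1), (fun=> v); split=> //; rewrite big_ord1//.
      by rewrite scale1r.
    by rewrite pi0 !scale0r.
  have pi_gt0 : 0 < p i by rewrite lt_def pi0 p0.
  have G2fin : (G i ^+ 2)%E \is a fin_num.
    rewrite ge0_fin_numE ?expe_ge0// ltey; apply/eqP => gy.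
    by move: (tfin i); rewrite gy gt0_muley ?lte_fin// ltxx.
  have := atomic_gauge_adherent V (psi i) (fine (G i ^+ 2)%E) e.
  rewrite fineK// => /(_ (lexx _) e0)[s [a [s0 Va psiE sr]]].
  exists (p i * s ^+ 2, a); split=> //=.
  - by rewrite mulr_ge0// sqr_ge0.
  - by rewrite psiE ketbraZ scalerA -rmorphM.
  - by rewrite -[X in (_ * X)%E]fineK// -EFinM -EFinD lee_fin -mulrDr ler_wpM2l.
move=> /all_and4[q0 qV qE qle].
have rhoq : rho = \sum_i (q i).1%:C *: ketbra (q i).2.
  by rewrite rhoE; apply: eq_bigr => i _; rewrite qE.
apply: (@le_trans _ _ (\sum_i (q i).1)%:E).
  rewrite {1}rhoq; apply: atomic_gauge_sum_le => //; last by move=> i; exists (q i).2.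
  (* Were the total weight zero, every weight would vanish and [rho] would be 0, against its trace
     being 1. *)
  rewrite lt_def sumr_ge0// andbT; apply/eqP => /psumr_eq0P s0.
  move: rho_tr1; rewrite rhoq big1 ?mxtrace0; first by move/eqP; rewrite eq_sym oner_eq0.
  by move=> i _; rewrite s0// scale0r.
have -> : e%:E = (\sum_i (p i * e)%:E)%E by rewrite sumEFin -mulr_suml p1 mul1r.
by rewrite -big_split/= -sumEFin; apply: lee_sum => i _.
Qed.

End ConvexRoof.

Theorem proposition5 (R : realType) (d : nat) (d_ge1 : (1 <= d)%N)
    (V : set 'cV[R[i]]_d)
    (V_neq0 : V !=set0)
    (V_compact : compact V)
    (V_unit : forall psi, V psi -> unit_vector psi)
    (V_phase : forall psi (t : R), V psi -> V (phase t *: psi))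
    (rho : 'M[R[i]]_d) (rho_density : density_matrix rho) :
  gauge_convex_roof V rho = atomic_gauge [set ketbra a | a in conv_hull V] rho.
Proof.
have [_ _ rho_tr1] := rho_density.
by apply/eqP; rewrite eq_le gauge_convex_roof_le//= atomic_gauge_le_roof.
Qed.
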